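(* Let $\Sigma=\{a,b,c\}$ be an alphabet with three distinct letters and let $w,w'\in\Sigma^*$ satisfy $|w|_{abc}=|w'|_{abc}\le 1$. Then $w$ and $w'$ are strongly $M$-equivalent if and only if $w$ and $w'$ are $M\!S\!E$-equivalent.
   Context: For words $w,u\in\Sigma^*$, $|w|_u$ is the number of occurrences of $u$ as a scattered subword of $w$ (two occurrences are different iff they differ in at least one position of some letter); $|w|_\lambda=1$ for the empty word $\lambda$. Parikh matrices: for an ordered alphabet $\Gamma=\{a_1<a_2<\dots<a_s\}$, the Parikh matrix mapping $\Psi_\Gamma:\Gamma^*\to\mathcal M_{s+1}$ is the monoid morphism into the multiplicative monoid of $(s+1)\times(s+1)$ upper triangular matrices with nonnegative integer entries and unit diagonal that sends $a_q$ to the matrix with $1$'s on the diagonal, $1$ in position $(q,q+1)$, and $0$ elsewhere. Two words are $M$-equivalent with respect to $\Gamma$ iff they have the same image under $\Psi_\Gamma$. Strong $M$-equivalence: for an (unordered) alphabet $\Sigma$, words $w,w'\in\Sigma^*$ are strongly $M$-equivalent iff they are $M$-equivalent with respect to every ordered alphabet whose underlying set is $\Sigma$. $M\!S\!E$-equivalence: Rule $S\!E$ allows one to replace a word $x\alpha\beta y\beta\alpha z$ by $x\beta\alpha y\alpha\beta z$, where $\alpha,\beta\in\Sigma$, $x,z\in\Sigma^*$ and $y\in\{\alpha,\beta\}^*$. Words $w,w'\in\Sigma^*$ are $M\!S\!E$-equivalent iff $w'$ results from $w$ by finitely many (possibly zero) applications of Rule $S\!E$. *)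

(* Defs.v *)
From mathcomp Require Import all_boot all_order all_algebra.
From Stdlib Require Import Relation_Operators.

Set Implicit Arguments.
Unset Strict Implicit.
Unset Printing Implicit Defensive.

Import GRing.Theory.
Local Open Scope ring_scope.

(* An occurrence of u as a scattered subword of w is a choice of positions
   of w, encoded as a bit mask of length size w. *)
Definition subword_count (T : eqType) (w u : seq T) : nat :=
  #|[set m : (size w).-tuple bool | mask m w == u]|.

(* The sequence [:: a_1; ...; a_s] stands for a_1 < ... < a_s. *)
Definition ordered_alphabet (T : finType) (G : seq T) : Prop :=
  uniq G /\ G =i T.

(* Indices start at 0: the off-diagonal 1 of the letter a_q is in row
   q - 1 = index a_q G and column q. *)
Definition letter_mx (T : eqType) (G : seq T) (x : T) : 'M[nat]_((size G).+1) :=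
  \matrix_(i, j) ((i == j) || ((i == index x G :> nat) && (j == i.+1 :> nat)) : nat).

Definition parikh_mx (T : eqType) (G w : seq T) : 'M[nat]_((size G).+1) :=
  \prod_(x <- w) letter_mx G x.

Definition M_equiv (T : eqType) (G w w' : seq T) : Prop :=
  parikh_mx G w = parikh_mx G w'.

Definition strongly_M_equiv (T : finType) (w w' : seq T) : Prop :=
  forall G : seq T, ordered_alphabet G -> M_equiv G w w'.

Inductive SE_step (T : eqType) : seq T -> seq T -> Prop :=
  SE_swap (x y z : seq T) (al be : T) :
    all (fun t => t \in [:: al; be]) y ->
    SE_step (x ++ [:: al; be] ++ y ++ [:: be; al] ++ z)
            (x ++ [:: be; al] ++ y ++ [:: al; be] ++ z).

Definition MSE_equiv (T : eqType) : seq T -> seq T -> Prop :=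
  clos_refl_trans (seq T) (@SE_step T).

(* Main.v *)
(* The entries of the Parikh matrices are subword counts |w|_u with u free of
   repeated letters, and Rule SE preserves all of these.  Conversely, over two
   letters x, y the numbers |w|_x, |w|_y, |w|_xy determine the MSE-class of w.
   If |w|_abc = 0 then w = u v t with u over {b,c}, v over {a,c}, t over {a,b};
   if |w|_abc = 1 then w = x a c^i b a^j c q with x over {b,c}, q over {a,b}.
   In the second case |w|_acb = i + |w|_ac |q|_b with i < |w|_ac, so i and |q|_b
   are a remainder and a quotient, and the binary counts of x and q follow.
   In the first case |w|_acb = |v|_ac |t|_b.  If |v|_ac > 0 this gives |t|_b, and
   the only freedom left is to move c's from the end of u to v and a's from the
   start of t to v; if |v|_ac = 0 then v is equivalent to some c^k a^l, hence is
   absorbed by u and t, and only b's can move between the two. *)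
Require Import Defs.
From mathcomp Require Import all_boot all_order all_algebra.
From Stdlib Require Import Relation_Operators.
From mathcomp Require Import zify.

Set Implicit Arguments.
Unset Strict Implicit.
Unset Printing Implicit Defensive.

(** * Two facts on natural numbers *)

Lemma quotient_unique n i i' r r' : i < n -> i' < n ->
  i + n * r = i' + n * r' -> r = r'.
Proof.
move=> i_n i'_n /(congr1 (divn^~ n)) /=.
by rewrite ![_ + n * _]addnC ![n * _]mulnC !divnMDl ?divn_small ?addn0; lia.
Qed.

(** The witnesses are the truncated differences in both directions; they tell how many letters one
    factor has in surplus over another. *)
Lemma shift_amounts (m n : nat) : exists d d' : nat, (d == 0) || (d' == 0) /\ m + d' = n + d.
Proof.
exists (m - n), (n - m); rewrite !subn_eq0 leq_total; split=> //.
by rewrite -!maxnE maxnC.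
Qed.

(** * Subword counts and their invariance under Rule SE *)

Section SubwordCount.
Variable T : eqType.
Implicit Types (x y : T) (w u s p z : seq T).
Notation sc := (@subword_count T).

Lemma subword_countE w u :
  sc w u = \sum_(m : (size w).-tuple bool) (mask m w == u).
Proof. by rewrite /subword_count -sum1dep_card big_mkcond; apply: eq_bigr => m _; case: eqP. Qed.

Lemma subword_count_cons x w u :
  sc (x :: w) u = sc w u + \sum_(m : (size w).-tuple bool) (x :: mask m w == u).
Proof.
rewrite !subword_countE /=.
(* A mask for [x :: w] is a first bit together with a mask for [w]; [h] and [g] are the two
   directions of this bijection. *)
pose h (q : bool * (size w).-tuple bool) := [tuple of q.1 :: q.2].
pose g (m : (size w).+1.-tuple bool) := (thead m, [tuple of behead m]).
rewrite (reindex h) /=; last first.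
  exists g => [[b m] _|m _]; first by congr (_, _); apply/val_inj.
  by rewrite [RHS]tuple_eta; apply/val_inj.
rewrite -(pair_bigA _ (fun b (m : (size w).-tuple bool) =>
  (mask (h (b, m)) (x :: w) == u) : nat)) /= big_bool addnC /=.
by congr (_ + _); apply: eq_bigr.
Qed.

Lemma subword_count_nil w : sc w [::] = 1.
Proof.
elim: w => [|x w IH]; last by rewrite subword_count_cons IH big1.
rewrite subword_countE (bigD1 [tuple]) //= big1 // => m.
by case/eqP; exact: tuple0.
Qed.

Lemma subword_count_nil_cons y u : sc [::] (y :: u) = 0.
Proof. by rewrite subword_countE big1 // => m _; rewrite (tuple0 m). Qed.

Lemma subword_count_cons_cons x w y u :
  sc (x :: w) (y :: u) = sc w (y :: u) + (x == y) * sc w u.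
Proof.
rewrite subword_count_cons; congr (_ + _).
rewrite subword_countE big_distrr /=; apply: eq_bigr => m _.
by rewrite eqseq_cons; case: eqP; case: eqP.
Qed.

Definition sc_simp :=
  (subword_count_nil, subword_count_nil_cons, subword_count_cons_cons).

Lemma subword_count_cat1 s w x : sc (s ++ w) [:: x] = sc s [:: x] + sc w [:: x].
Proof. by elim: s => [|t s IH] //=; rewrite !sc_simp // IH; lia. Qed.

Lemma subword_count_cat2 s w x y :
  sc (s ++ w) [:: x; y] =
  sc s [:: x; y] + sc s [:: x] * sc w [:: y] + sc w [:: x; y].
Proof.
elim: s => [|t s IH] /=; first by rewrite !sc_simp.
by rewrite !sc_simp IH subword_count_cat1; lia.
Qed.

Lemma subword_count_cat3 s w x y (z : T) :
  sc (s ++ w) [:: x; y; z] =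
  sc s [:: x; y; z] + sc s [:: x; y] * sc w [:: z]
  + sc s [:: x] * sc w [:: y; z] + sc w [:: x; y; z].
Proof.
elim: s => [|t s IH] /=; first by rewrite !sc_simp.
by rewrite !sc_simp IH subword_count_cat2; lia.
Qed.

(** A position of [x] and a position of [y] differ, hence come in exactly one of the two orders. *)
Lemma subword_count_pair w x y : x != y ->
  sc w [:: x; y] + sc w [:: y; x] = sc w [:: x] * sc w [:: y].
Proof.
move=> xy; elim: w => [|t w IH]; rewrite !sc_simp //.
case: (eqVneq t x) => [->|tx]; last by case: eqP => ? /=; lia.
by rewrite (negbTE xy) /=; lia.
Qed.

Lemma subword_count_eq0 w u x : x \in u -> x \notin w -> sc w u = 0.
Proof.
elim: w u => [|t w IH] [|y u] //; first by rewrite sc_simp.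
rewrite !inE negb_or sc_simp => xu /andP[xt xw].
rewrite (IH (y :: u)) ?inE //; case: eqP => // ty.
by rewrite (IH u) //; move: xu; rewrite -ty (negbTE xt).
Qed.

Lemma subword_count1_gt0 w x : (0 < sc w [:: x]) = (x \in w).
Proof.
elim: w => [|t w IH]; rewrite !sc_simp // inE -IH eq_sym.
by case: eqP => /= ?; lia.
Qed.

Lemma subword_count_nseq1 n x y : sc (nseq n x) [:: y] = (x == y) * n.
Proof. by elim: n => [|n IH]; rewrite /= !sc_simp ?IH; lia. Qed.

Lemma subword_count_nseq2 n x y (z : T) : y != z -> sc (nseq n x) [:: y; z] = 0.
Proof.
move=> yz; elim: n => [|n IH]; rewrite /= !sc_simp // IH subword_count_nseq1.
by case: eqP => //= ->; rewrite (negbTE yz).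
Qed.

Lemma subword_count_skip p w u :
  (forall t, t \in u -> t \notin p) -> sc (p ++ w) u = sc w u.
Proof.
elim: p => [|t p IH] //= H; rewrite -IH; last first.
  by move=> y /H; rewrite inE negb_or => /andP[].
case: u H {IH} => [|y u] H; rewrite !sc_simp //.
by case: eqP => [ty|_]; [move: (H y (mem_head _ _)); rewrite ty mem_head | lia].
Qed.

(* Moving a factor [al be] to [be al] changes the count of [u] only if [u]
   starts with these two letters: after a prefix over [al] and [be], at most
   one further letter of the pair is left in [u]. *)
Lemma subword_count_swap p z u al be :
  uniq u -> all (fun t => t \in [:: al; be]) p ->
  sc (p ++ [:: al, be & z]) u + prefix [:: be; al] u * sc z (drop 2 u) =
  sc (p ++ [:: be, al & z]) u + prefix [:: al; be] u * sc z (drop 2 u).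
Proof.
elim: p u => [|t p IH] u uu.
  move=> _; case: u uu => [|y [|y' u]]; rewrite /= ?sc_simp ?drop0 ?andbF //; first lia.
  rewrite !inE negb_or => /andP[/andP[yy' _] _].
  rewrite ?prefix0s ?andbT [al == y]eq_sym [be == y]eq_sym.
  rewrite [al == y']eq_sym [be == y']eq_sym.
  by case: (y == al); case: (y == be); case: (y' == al); case: (y' == be) => /=; lia.
case: u uu => [|y u] uu; first by rewrite !sc_simp.
case/andP=> tab pab; rewrite !cat_cons !sc_simp.
have := IH _ uu pab; case: eqP => [ty|_]; last by rewrite !mul0n !addn0.
case/andP: uu => yu uu; have := IH _ uu pab.
(* Here [t], one of [al] and [be], equals the head [y], so it is missing from [u], which cannot
   start with both letters: its correction terms vanish. *)
have pre0 x x' : t \in [:: x; x'] -> prefix [:: x; x'] u = false.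
  case: u yu {uu IH} => [|v [|v' u]] //= yu; rewrite ?andbF // prefix0s andbT.
  rewrite !inE => txx; apply/negP => /andP[/eqP xv /eqP xv'].
  by move: yu txx; rewrite !inE !negb_or ty xv xv' => /and3P[/negbTE-> /negbTE->].
rewrite !pre0 //; first by lia.
by move: tab; rewrite !inE orbC.
Qed.

(** Rule SE makes two swaps in opposite directions, each with a correction term. The corrections
    cancel: if [u] starts with the two letters, they do not recur in [u], so the block over [al] and
    [be] between the swaps can be skipped. *)
Lemma SE_step_subword_count w w' u : uniq u -> SE_step w w' -> sc w u = sc w' u.
Proof.
move=> + st; case: w w' / st => x y z al be yab.
elim: x u => [|t x IH] u uu; last first.
  case: u uu => [|v u] uu; rewrite !cat_cons !sc_simp // IH // IH //.
  by case/andP: uu.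
have H1 := subword_count_swap (p := [::]) (al := al) (be := be) (y ++ [:: be; al] ++ z) uu isT.
have pab : all (fun t => t \in [:: al; be]) ([:: be; al] ++ y).
  by rewrite all_cat yab /= !inE !eqxx !orbT.
move: H1 (subword_count_swap z uu pab); rewrite -!catA !cat_cons !cat0s.
have skip x1 x2 : ([:: x1; x2] =i [:: al; be]) ->
  prefix [:: x1; x2] u * sc (y ++ [:: be, al & z]) (drop 2 u) =
  prefix [:: x1; x2] u * sc z (drop 2 u).
  move=> E; case: u uu => [|v [|v' u]] //= uu; rewrite ?andbF // prefix0s andbT drop0.
  case: eqP => //= ev; case: eqP => //= ev'.
  rewrite -[y ++ _]/(y ++ [:: be; al] ++ z) catA subword_count_skip // => q qu.
  apply/negP => qy; have : q \in [:: al; be].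
    move: qy; rewrite mem_cat => /orP[/(allP yab) //|].
    by rewrite !inE orbC.
  rewrite -E ev ev' !inE => qv; move: uu qu; rewrite !inE negb_or.
  by case/orP: qv => /eqP-> /and3P[/andP[_ h1] h2 _] h3; rewrite h3 in h1 h2.
rewrite !skip //; first by lia.
by move=> q; rewrite !inE orbC.
Qed.

Lemma MSE_subword_count w w' u : uniq u -> MSE_equiv w w' -> sc w u = sc w' u.
Proof.
move=> uu; elim=> [x y /(SE_step_subword_count uu) //|//|x y z _ -> _ -> //].
Qed.

(** * Entries of Parikh matrices *)

Lemma parikh_mx_cons (G : seq T) x w (i j : 'I_(size G).+1) :
  parikh_mx G (x :: w) i j =
  parikh_mx G w i j +
  \sum_(k < (size G).+1 | (i == index x G :> nat) && (k == i.+1 :> nat))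
     parikh_mx G w k j.
Proof.
rewrite /parikh_mx big_cons mxE.
set P := (\prod_(y <- w) _)%R.
transitivity (\sum_(k < (size G).+1) ((i == k) * P k j +
   ((i == index x G :> nat) && (k == i.+1 :> nat)) * P k j)).
  apply: eq_bigr => k _; rewrite mxE.
  have -> : forall u v : nat, (u * v)%R = u * v by [].
  by rewrite -mulnDl; congr (_ * _); rewrite -val_eqE /=; lia.
rewrite big_split /=; congr (_ + _).
  rewrite (bigD1 i) //= eqxx mul1n big1 ?addn0 // => k.
  by rewrite eq_sym => /negbTE->.
by rewrite [RHS]big_mkcond; apply: eq_bigr => k _; case: ifP; rewrite ?mul1n.
Qed.

(** Prefixing a letter [x] adds to row [index x G] the row below it; this is the recursion of
    [subword_count_cons_cons] for factors of [G]. *)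
Lemma parikh_mx_entry (G w : seq T) (i j : 'I_(size G).+1) : uniq G ->
  parikh_mx G w i j = if i <= j then sc w (take (j - i) (drop i G)) else 0.
Proof.
move=> uG; elim: w i => [|x w IH] i.
  rewrite /parikh_mx big_nil mxE -val_eqE /=.
  case: (ltngtP i j) => [ij|//|->]; last by rewrite subnn take0 sc_simp.
  have iG : i < size G by rewrite (leq_trans ij) // -ltnS.
  case: (drop i G) (size_drop i G) => [|y s] /=; first lia.
  by case E : (j - i) => [|n] //= _; rewrite ?sc_simp //; lia.
rewrite parikh_mx_cons IH.
have [iG|Gi] := ltnP i (size G); last first.
  rewrite big1 => [|k /andP[_]]; last by have := ltn_ord k; lia.
  by rewrite drop_oversize // addn0; case: (j - i) => [|n]; rewrite /= !sc_simp.
have iG' : i.+1 < (size G).+1 by [].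
have -> : \sum_(k < (size G).+1 | (i == index x G :> nat) && (k == i.+1 :> nat))
     parikh_mx G w k j = (i == index x G :> nat) * parikh_mx G w (Ordinal iG') j.
  case: eqP => _; last by rewrite big1.
  by rewrite (big_pred1 (Ordinal iG')) ?mul1n.
rewrite IH /=; case: (ltngtP i j) => [ij|ji|ij]; last 2 first.
- by rewrite muln0.
- by rewrite ij subnn !take0 !sc_simp muln0.
rewrite (drop_nth x) // -[j - i]prednK ?subn_gt0 //= sc_simp -subnS.
congr (_ + _ * _); congr nat_of_bool; apply/eqP/eqP => [ix|->].
  by rewrite ix nth_index // -index_mem -ix.
by rewrite index_uniq.
Qed.
End SubwordCount.

(** * MSE-equivalence and its invariants on two letters *)

Section MSE.
Variable T : eqType.
Implicit Types (x y : T) (w u s p : seq T).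
Notation sc := (@subword_count T).
Notation MSE := (@MSE_equiv T).

Lemma MSE_refl w : MSE w w. Proof. exact: rt_refl. Qed.

Lemma MSE_trans w1 w2 w3 : MSE w1 w2 -> MSE w2 w3 -> MSE w1 w3.
Proof. exact: rt_trans. Qed.

Lemma MSE_sym w w' : MSE w w' -> MSE w' w.
Proof.
elim=> [_ _ [x y z al be yab]|u|u v z _ IH1 _ IH2].
- apply: rt_step; apply: SE_swap; apply: sub_all yab => t.
  by rewrite !inE orbC.
- exact: MSE_refl.
- exact: MSE_trans IH2 IH1.
Qed.

Lemma MSE_ctx p s w w' : MSE w w' -> MSE (p ++ w ++ s) (p ++ w' ++ s).
Proof.
elim=> [_ _ [x y z al be yab]|u|u v z _ IH1 _ IH2].
- have := SE_swap (p ++ x) (z ++ s) yab.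
  by rewrite !catA -!catA => /(@rt_step _ _ _ _).
- exact: MSE_refl.
- exact: MSE_trans IH1 IH2.
Qed.

Lemma MSE_cons x w w' : MSE w w' -> MSE (x :: w) (x :: w').
Proof. by move/(MSE_ctx [:: x] [::]); rewrite !cats0. Qed.

Lemma MSE_cat w1 w1' w2 w2' :
  MSE w1 w1' -> MSE w2 w2' -> MSE (w1 ++ w2) (w1' ++ w2').
Proof.
move=> /(MSE_ctx [::] w2) h1 /(MSE_ctx w1' [::]); rewrite !cats0.
exact: MSE_trans.
Qed.

Lemma MSE_all (P : pred T) w w' : MSE w w' -> all P w = all P w'.
Proof.
elim=> [_ _ [x y z al be yab]|//|u v z _ -> _ -> //].
by rewrite !all_cat /= !andbT [P al && P be]andbC.
Qed.

Notation binary x y w := (all (fun t => t \in [:: x; y]) w).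

(** The part [s1] is later the middle block of Rule SE, hence the claim that it is binary. *)
Lemma binary_factor x y s : x != y -> binary x y s -> 0 < sc s [:: y; x] ->
  exists s1 s2, s = s1 ++ [:: y; x] ++ s2 /\ binary x y s1.
Proof.
move=> xy; elim: s => [|t s IH] //=; first by rewrite sc_simp.
move=> /andP[txy sxy]; have [s_yx|] := posnP (sc s [:: y; x]); last first.
  move/(IH sxy) => [s1 [s2 [-> s1xy]]] _.
  by exists (t :: s1), s2; rewrite /= txy.
(* The tail has no [y x], so the head is [y] and some [x] follows; a second letter [y] would give
   the tail an occurrence of [y x]. *)
move: txy sxy s_yx {IH}; rewrite sc_simp !inE => /orP[] /eqP->.
  by rewrite (negbTE xy) => _ ->.
case: s => [|v s] /=; first by rewrite !sc_simp muln0.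
rewrite [v \in _]inE mem_seq1 eqxx => /andP[/orP[]/eqP-> _].
  by exists [::], s.
by rewrite !sc_simp eqxx [y == x]eq_sym (negbTE xy); lia.
Qed.

(* The inequality says that [w] has more than enough inversions: while [y] is
   preceded by some [x], the rest of the word has a factor [y x] with which
   the factor [x y] can be exchanged. *)
Lemma MSE_front x y w : x != y -> binary x y w -> y \in w ->
  sc w [:: x] <= sc w [:: y; x] -> exists u, MSE w (y :: u).
Proof.
move=> xy wxy yw.
have [k [s def_w]] : exists k s, w = nseq k x ++ y :: s.
  elim: w wxy yw => [|t w IH] //= /andP[].
  rewrite [t \in _]inE orbC => /orP[]; first by rewrite inE => /eqP-> *; exists 0, w.
  move=> /eqP-> wxy; rewrite inE eq_sym (negbTE xy) /= => yw.
  by have [k [s ->]] := IH wxy yw; exists k.+1, s.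
elim: k s w def_w {yw} wxy => [|k IH] s w -> wxy cnt; first by exists s; apply: MSE_refl.
have yx : (y == x) = false by rewrite eq_sym (negbTE xy).
(* Since [y] first occurs after [k.+1] letters [x], the inequality leaves at least [k.+1]
   occurrences of [y x] to [s]. *)
have : 0 < sc s [:: y; x].
  move: cnt; rewrite subword_count_cat1 subword_count_cat2 !sc_simp.
  by rewrite !subword_count_nseq1 subword_count_nseq2 1?eq_sym // !eqxx (negbTE xy); lia.
have sxy : binary x y s by move: wxy; rewrite all_cat => /andP[_ /= /andP[]].
move/(binary_factor xy sxy) => [s1 [s2 [def_s s1xy]]].
pose w' := nseq k x ++ y :: (x :: s1 ++ [:: x; y] ++ s2).
have ww' : MSE (nseq k.+1 x ++ y :: s) w'.
  by rewrite def_s -addn1 nseqD -catA; apply: rt_step; apply: SE_swap.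
have [] := IH _ w' erefl.
- by rewrite -(MSE_all _ ww').
- by rewrite -!(MSE_subword_count _ ww') //= inE yx.
- by move=> u /(MSE_trans ww'); exists u.
Qed.

(** Induction on [w']: [w] is brought to start with the head of [w'], and the common head is
    removed; invariance of the counts carries the hypotheses to the tails. *)
Lemma MSE_binary x y w w' : x != y -> binary x y w -> binary x y w' ->
  sc w [:: x] = sc w' [:: x] -> sc w [:: y] = sc w' [:: y] ->
  sc w [:: x; y] = sc w' [:: x; y] -> MSE w w'.
Proof.
move=> xy; have yx : y != x by rewrite eq_sym.
elim: w' w => [|t' w' IH] w.
  case: w => [|t w] /=; first by move=> *; exact: MSE_refl.
  rewrite !inE !sc_simp => /andP[txy _].
  by case/orP: txy => /eqP->; rewrite !eqxx; lia.
move=> wxy w'xy cx cy cxy.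
have cyx : sc w [:: y; x] = sc (t' :: w') [:: y; x].
  by have := subword_count_pair w xy; have := subword_count_pair (t' :: w') xy; lia.
have step u : MSE w (t' :: u) -> MSE w (t' :: w').
  move=> wu; apply: (MSE_trans wu); apply: MSE_cons; apply: IH.
  - by move: wxy; rewrite (MSE_all _ wu) => /andP[].
  - by case/andP: w'xy.
  - by move: cx; rewrite (MSE_subword_count _ wu) // !sc_simp; lia.
  - by move: cy; rewrite (MSE_subword_count _ wu) // !sc_simp; lia.
  - move: cxy cy; rewrite !(MSE_subword_count _ wu) //= ?inE ?xy // !sc_simp; lia.
case: w wxy cx cy cxy cyx step => [|t w].
  case/andP: w'xy => + _; rewrite !inE !sc_simp.
  by case/orP=> /eqP->; rewrite !eqxx; lia.
move=> wxy cx cy cxy cyx step.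
have [tt'|tt'] := eqVneq t t'; first by rewrite tt' in step *; exact: (step w (MSE_refl _)).
have letters : (t = x /\ t' = y) \/ (t = y /\ t' = x).
  case/andP: wxy tt' => + _; case/andP: w'xy => + _; rewrite !inE.
  by move=> /orP[]/eqP-> /orP[]/eqP->; rewrite ?eqxx; [|right|left|].
have cnt u z : 0 < sc (z :: u) [:: z] by rewrite !sc_simp eqxx; lia.
(* Every [t] in [t' :: w'] comes after its head, so that word has at least as many [t' t] as [t]. By
   equality of counts so has [t :: w], as [MSE_front] requires. *)
have front : exists u, MSE (t :: w) (t' :: u).
  apply: (@MSE_front t t') => //.
  - case: letters wxy => -[-> ->] // wxy.
    by apply/allP => z /(allP wxy); rewrite !inE orbC.
  - by rewrite -subword_count1_gt0; case: letters cx cy => -[-> ->] cx cy; rewrite ?cx ?cy cnt.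
  - by case: letters cx cy cxy cyx => -[-> ->] cx cy cxy cyx;
      rewrite ?cx ?cy ?cxy ?cyx !sc_simp eqxx ?(negbTE xy) ?(negbTE yx); lia.
by case: front => u; apply: step.
Qed.
End MSE.

(** * Splitting off surplus letters at an end of a binary word *)

Section Absorb.
Variable T : eqType.
Implicit Types (x y : T) (w u s : seq T).
Notation sc := (@subword_count T).
Notation MSE := (@MSE_equiv T).
Notation binary x y w := (all (fun t => t \in [:: x; y]) w).

Lemma binaryC x y w : binary x y w = binary y x w.
Proof. by apply: eq_all => t; rewrite !inE orbC. Qed.

Lemma binary_nseq x y n : binary x y (nseq n x) && binary x y (nseq n y).
Proof. by rewrite !all_nseq !inE !eqxx !orbT. Qed.

(** The count hypotheses say that [u ++ nseq d' y] and [u' ++ nseq d y] have equal counts. As [d] or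
    [d'] is 0, one of [u] and [u'] serves as [u1]. *)
Lemma MSE_binary_suffix x y u u' d d' : x != y ->
  binary x y u -> binary x y u' -> (d == 0) || (d' == 0) ->
  sc u [:: x] = sc u' [:: x] -> sc u [:: y] + d' = sc u' [:: y] + d ->
  sc u [:: x; y] + sc u [:: x] * d' = sc u' [:: x; y] + sc u [:: x] * d ->
  exists u1, MSE u (u1 ++ nseq d y) /\ MSE u' (u1 ++ nseq d' y).
Proof.
move=> xy uxy u'xy dd cx cy cxy; have yx : y != x by rewrite eq_sym.
have /andP[_ nd] := binary_nseq x y d; have /andP[_ nd'] := binary_nseq x y d'.
case/orP: dd => /eqP d0; subst.
  exists u; rewrite cats0; split; first exact: MSE_refl.
  apply: (MSE_binary xy) => //; rewrite ?all_cat ?uxy ?subword_count_cat1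
    ?subword_count_cat2 ?subword_count_nseq2 // !subword_count_nseq1 ?eqxx ?(negbTE yx); lia.
exists u'; rewrite cats0; split; last exact: MSE_refl.
apply: (MSE_binary xy) => //; rewrite ?all_cat ?u'xy ?subword_count_cat1
  ?subword_count_cat2 ?subword_count_nseq2 // !subword_count_nseq1 ?eqxx ?(negbTE yx); lia.
Qed.

(** Mirror image of [MSE_binary_suffix]: the surplus letters [x] stand in front. *)
Lemma MSE_binary_prefix x y u u' d d' : x != y ->
  binary x y u -> binary x y u' -> (d == 0) || (d' == 0) ->
  sc u [:: y] = sc u' [:: y] -> sc u [:: x] + d' = sc u' [:: x] + d ->
  sc u [:: x; y] + sc u [:: y] * d' = sc u' [:: x; y] + sc u [:: y] * d ->
  exists u1, MSE u (nseq d x ++ u1) /\ MSE u' (nseq d' x ++ u1).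
Proof.
move=> xy uxy u'xy dd cx cy cxy; have yx : y != x by rewrite eq_sym.
have /andP[nd _] := binary_nseq x y d; have /andP[nd' _] := binary_nseq x y d'.
case/orP: dd => /eqP d0; subst.
  exists u; split; first exact: MSE_refl.
  apply: (MSE_binary xy) => //; rewrite ?all_cat ?nd' ?uxy ?subword_count_cat1
    ?subword_count_cat2 ?subword_count_nseq2 // !subword_count_nseq1 ?eqxx ?(negbTE xy); lia.
exists u'; split; last exact: MSE_refl.
apply: (MSE_binary xy) => //; rewrite ?all_cat ?nd ?u'xy ?subword_count_cat1
  ?subword_count_cat2 ?subword_count_nseq2 // !subword_count_nseq1 ?eqxx ?(negbTE xy); lia.
Qed.

(** Stated as a tuple of equations so that it acts as one rewrite rule. *)
Lemma subword_count_absent x w : x \notin w ->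
  (forall s, sc w (x :: s) = 0) * (forall y s, sc w (y :: x :: s) = 0) *
  (forall y z s, sc w [:: y, z, x & s] = 0).
Proof.
by move=> xw; split; first split => *;
  try move=> *; apply: (subword_count_eq0 _ xw); rewrite !inE eqxx ?orbT.
Qed.

Lemma binary_notin x y z w : binary x y w -> z != x -> z != y -> z \notin w.
Proof.
move=> wxy zx zy; apply/negP => /(allP wxy).
by rewrite !inE (negbTE zx) (negbTE zy).
Qed.

Lemma subword_count_cons_eq0 y u w : sc w u = 0 -> sc w (y :: u) = 0.
Proof.
elim: w => [|t w IH] //; first by rewrite sc_simp.
case: u IH => [|v u] IH; rewrite !sc_simp // => h.
rewrite IH; last lia.
by case: (sc w (v :: u)) h => [|//]; rewrite muln0.
Qed.
Lemma MSE_binary_sorted x y u : x != y -> binary x y u -> sc u [:: x; y] = 0 ->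
  MSE u (nseq (sc u [:: y]) y ++ nseq (sc u [:: x]) x).
Proof.
move=> xy uxy cxy; have yx : y != x by rewrite eq_sym.
apply: (MSE_binary xy) => //.
- have /andP[nx _] := binary_nseq x y (sc u [:: x]).
  by have /andP[_ ny] := binary_nseq x y (sc u [:: y]); rewrite all_cat nx ny.
- by rewrite subword_count_cat1 !subword_count_nseq1 eqxx (negbTE yx) mul1n.
- by rewrite subword_count_cat1 !subword_count_nseq1 eqxx (negbTE xy) mul1n addn0.
- by rewrite subword_count_cat2 !subword_count_nseq2 // !subword_count_nseq1 (negbTE yx).
Qed.
End Absorb.

(** * Factorizations of ternary words with at most one occurrence of [a b c] *)

Section Ternary.
Variables (T : eqType) (a b c : T).
Hypotheses (ab : a != b) (bc : b != c) (ac : a != c).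
Hypothesis abc : forall t, t \in [:: a; b; c].
Implicit Types w u v x q : seq T.
Notation sc := (@subword_count T).
Notation MSE := (@MSE_equiv T).
Notation binary x y w := (all (fun t => t \in [:: x; y]) w).

Let ba : b != a. Proof. by rewrite eq_sym. Qed.
Let cb : c != b. Proof. by rewrite eq_sym. Qed.
Let ca : c != a. Proof. by rewrite eq_sym. Qed.
Let letter_neq := (negbTE ab, negbTE ba, negbTE bc, negbTE cb, negbTE ac, negbTE ca, eqxx).

Lemma letterP y : [\/ y = a, y = b | y = c].
Proof.
have := abc y; rewrite !inE => /or3P[]/eqP->.
- exact: Or31. - exact: Or32. - exact: Or33.
Qed.

(** A head [a] or [c] extends [v]. A head [b] excludes every later [c], so then the whole word can
    be taken as [t]. *)
Lemma bc_avoiding w : sc w [:: b; c] = 0 ->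
  exists v (t : seq T), [/\ w = v ++ t, binary a c v & binary a b t].
Proof.
elim: w => [|y w IH]; first by exists [::], [::].
rewrite sc_simp => h; have [|v [t [def_w v_ac t_ab]]] := IH; first lia.
case: (letterP y) h; rewrite def_w => -> h.
- by exists (a :: v), t; rewrite /= !inE eqxx.
- exists [::], (b :: v ++ t); split=> //.
  have : c \notin v by rewrite -subword_count1_gt0; move: h; rewrite subword_count_cat1 eqxx; lia.
  rewrite /= all_cat t_ab !inE eqxx orbT andbT /= => cv.
  apply/allP => z zv; have := allP v_ac z zv; rewrite !inE => /orP[->//|/eqP zc].
  by rewrite -zc zv in cv.
- by exists (c :: v), t; rewrite /= !inE eqxx orbT.
Qed.

(** The factor [u] ends before the first [a]; what follows that [a] avoids [b c]. *)
Lemma abc_avoiding w : sc w [:: a; b; c] = 0 ->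
  exists u v (t : seq T), [/\ w = u ++ v ++ t, binary b c u, binary a c v & binary a b t].
Proof.
elim: w => [|y w IH]; first by exists [::], [::], [::].
rewrite sc_simp => h.
have [ya|ya] := eqVneq y a.
  have [|v [t [-> v_ac t_ab]]] := @bc_avoiding w; first by move: h; rewrite ya eqxx; lia.
  by exists [::], (y :: v), t; split; rewrite //= ya !inE eqxx.
have [|u [v [t [-> u_bc v_ac t_ab]]]] := IH; first lia.
exists (y :: u), v, t; split=> //=; rewrite u_bc andbT.
by have := abc y; rewrite !inE (negbTE ya).
Qed.

Lemma c_once w : sc w [:: c] = 1 -> sc w [:: b; c] = 0 ->
  exists j q, w = nseq j a ++ c :: q /\ binary a b q.
Proof.
elim: w => [|y w IH]; rewrite !sc_simp // => h h'.
case: (letterP y) h h' => ->; rewrite !letter_neq => h h'.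
- by have [||j [q [-> q_ab]]] := IH; [lia|lia|exists j.+1, q].
- lia.
- exists 0, w; split=> //; apply/allP => z zw.
  have : c \notin w by rewrite -subword_count1_gt0; lia.
  case: (letterP z) zw => -> zw; rewrite !inE ?eqxx ?orbT //.
  by rewrite zw.
Qed.

(** No [a] can precede the single [b c], so only letters [c] stand before its [b]; after this [b]
    there is exactly one [c] and no further [b c]. *)
Lemma bc_once w : sc w [:: a; b; c] = 0 -> sc w [:: b; c] = 1 ->
  exists i j q, w = nseq i c ++ b :: nseq j a ++ c :: q /\ binary a b q.
Proof.
elim: w => [|y w IH]; rewrite !sc_simp // => h h'.
case: (letterP y) h h' => ->; rewrite !letter_neq => h h'.
- lia.
- case: (posnP (sc w [:: c])) => c_w.
    by have := subword_count_cons_eq0 b c_w; lia.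
  have [||j [q [-> q_ab]]] := @c_once w; [lia|lia|by exists 0, j, q].
- by have [||i [j [q [-> q_ab]]]] := IH; [lia|lia|exists i.+1, j, q].
Qed.

(** The factor [x] ends before the first [a]. A rest without [b c] would leave no [a b c] at all, so
    the rest has one [b c] and no [a b c]. *)
Lemma abc_once w : sc w [:: a; b; c] = 1 ->
  exists x i j q, [/\ w = x ++ a :: nseq i c ++ b :: nseq j a ++ c :: q,
                      binary b c x & binary a b q].
Proof.
elim: w => [|y w IH]; rewrite !sc_simp // => h.
have [ya|ya] := eqVneq y a; last first.
  have [|x [i [j [q [-> x_bc q_ab]]]]] := IH; first by rewrite (negbTE ya) in h; lia.
  exists (y :: x), i, j, q; split=> //=; rewrite x_bc andbT.
  by have := abc y; rewrite !inE (negbTE ya).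
move: h; rewrite ya eqxx => h.
case: (posnP (sc w [:: b; c])) => bc_w.
  by have := subword_count_cons_eq0 a bc_w; lia.
have [||i [j [q [-> q_ab]]]] := @bc_once w; [lia|lia|].
by exists [::], i, j, q.
Qed.

(** * Equal counts for the orders a < b < c and a < c < b imply MSE-equivalence *)

Section Converse.
Variables w w' : seq T.
Hypotheses (e_a : sc w [:: a] = sc w' [:: a]) (e_b : sc w [:: b] = sc w' [:: b])
  (e_c : sc w [:: c] = sc w' [:: c]) (e_ab : sc w [:: a; b] = sc w' [:: a; b])
  (e_bc : sc w [:: b; c] = sc w' [:: b; c]) (e_ac : sc w [:: a; c] = sc w' [:: a; c])
  (e_acb : sc w [:: a; c; b] = sc w' [:: a; c; b]).

Let absent_a u (h : binary b c u) := subword_count_absent (binary_notin h ab ac).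
Let absent_b u (h : binary a c u) := subword_count_absent (binary_notin h ba bc).
Let absent_c u (h : binary a b u) := subword_count_absent (binary_notin h ca cb).

Lemma MSE_abc_once : sc w [:: a; b; c] = 1 -> sc w' [:: a; b; c] = 1 -> MSE w w'.
Proof.
have counts x i j q : binary b c x -> binary a b q ->
    let v := x ++ [:: a] ++ nseq i c ++ [:: b] ++ nseq j a ++ [:: c] ++ q in
    [/\ sc v [:: a] = 1 + j + sc q [:: a], sc v [:: b] = sc x [:: b] + 1 + sc q [:: b],
        sc v [:: c] = sc x [:: c] + i + 1
      & [/\ sc v [:: a; b] = 1 + (1 + j) * sc q [:: b] + sc q [:: a; b],
        sc v [:: b; c] = sc x [:: b; c] + sc x [:: b] * (i + 1) + 1,
        sc v [:: a; c] = i + 1 + j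
      & sc v [:: a; c; b] = i + (i + 1 + j) * sc q [:: b]]].
  move=> /absent_a x_a /absent_c q_c v.
  rewrite /v !subword_count_cat3 !subword_count_cat2 !subword_count_cat1.
  have absent_nseq (y z : T) n : y != z -> y \notin nseq n z.
    by rewrite mem_nseq negb_and => ->; rewrite orbT.
  have c_a := subword_count_absent (absent_nseq _ _ i ac).
  have c_b := subword_count_absent (absent_nseq _ _ i bc).
  have a_b := subword_count_absent (absent_nseq _ _ j ba).
  have a_c := subword_count_absent (absent_nseq _ _ j ca).
  rewrite !x_a !q_c !c_a !c_b !a_b !a_c !subword_count_nseq1 !sc_simp !letter_neq /=.
  by split; [lia|lia|lia|split; lia].
move=> /abc_once-[x [i [j [q [def_w x_bc q_ab]]]]].
move=> /abc_once-[x' [i' [j' [q' [def_w' x'_bc q'_ab]]]]].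
have [] := counts _ i j _ x_bc q_ab; have [] := counts _ i' j' _ x'_bc q'_ab.
rewrite /= -def_w -def_w' -e_a -e_b -e_c -e_ab -e_bc -e_ac -e_acb.
(* Eliminating the common counts leaves equations between the parameters of the two
   factorizations. *)
move=> {counts} -> -> -> [-> -> -> ->] h_a h_b h_c [h_ab h_bc h_ac h_acb].
have eq_q : sc q [:: b] = sc q' [:: b].
  rewrite -h_ac in h_acb; apply/esym/(quotient_unique _ _ h_acb).
    by rewrite addn1 addSn ltnS leq_addr.
  by rewrite h_ac addn1 addSn ltnS leq_addr.
have eq_i : i = i'.
  by move: h_acb; rewrite eq_q h_ac => /eqP; rewrite eqn_add2r => /eqP.
have eq_j : j = j' by clear -h_ac eq_i; lia.
have eq_x : sc x [:: b] = sc x' [:: b] by clear -h_b eq_q; lia.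
rewrite eq_j eq_q in h_ab; rewrite eq_i eq_x in h_bc.
rewrite def_w def_w' eq_i eq_j; apply: MSE_cat.
  apply: (MSE_binary bc) => //; [clear -h_c eq_i|clear -h_bc]; lia.
do ![apply: MSE_cat; first exact: MSE_refl | apply: MSE_cons].
by apply: (MSE_binary ab) => //; [clear -h_a eq_j|clear -h_ab]; lia.
Qed.

Lemma MSE_abc_avoiding :
  sc w [:: a; b; c] = 0 -> sc w' [:: a; b; c] = 0 -> MSE w w'.
Proof.
have counts u v (t : seq T) : binary b c u -> binary a c v -> binary a b t ->
    let s := u ++ v ++ t in
    [/\ sc s [:: a] = sc v [:: a] + sc t [:: a], sc s [:: b] = sc u [:: b] + sc t [:: b],
        sc s [:: c] = sc u [:: c] + sc v [:: c]
      & [/\ sc s [:: a; b] = sc v [:: a] * sc t [:: b] + sc t [:: a; b],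
        sc s [:: b; c] = sc u [:: b; c] + sc u [:: b] * sc v [:: c],
        sc s [:: a; c] = sc v [:: a; c]
      & sc s [:: a; c; b] = sc v [:: a; c] * sc t [:: b]]].
  move=> /absent_a u_a /absent_b v_b /absent_c t_c s.
  rewrite /s !subword_count_cat3 !subword_count_cat2 !subword_count_cat1.
  by rewrite !u_a !v_b !t_c; split; [lia|lia|lia|split; lia].
move=> /abc_avoiding-[u [v [t [def_w u_bc v_ac t_ab]]]].
move=> /abc_avoiding-[u' [v' [t' [def_w' u'_bc v'_ac t'_ab]]]].
have [] := counts _ _ _ u_bc v_ac t_ab; have [] := counts _ _ _ u'_bc v'_ac t'_ab.
rewrite /= -def_w -def_w' -e_a -e_b -e_c -e_ab -e_bc -e_ac -e_acb.
move=> {counts} -> -> -> [-> -> -> ->] h_a h_b h_c [h_ab h_bc h_ac h_acb].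
have [v_eq0|v_gt0] := posnP (sc v [:: a; c]).
  have [d [d' [dd' h_d]]] := shift_amounts (sc u [:: b]) (sc u' [:: b]).
  (* Here [v] is equivalent to letters [c] followed by letters [a]; the former are absorbed by [u],
     the latter by [t]. *)
  pose U := u ++ nseq (sc v [:: c]) c; pose U' := u' ++ nseq (sc v' [:: c]) c.
  pose V := nseq (sc v [:: a]) a ++ t; pose V' := nseq (sc v' [:: a]) a ++ t'.
  have [|||||u1 [Uu1 U'u1]] := @MSE_binary_suffix _ c b U U' d d' cb _ _ dd'.
  - by rewrite all_cat binaryC u_bc; case/andP: (binary_nseq c b (sc v [:: c])).
  - by rewrite all_cat binaryC u'_bc; case/andP: (binary_nseq c b (sc v' [:: c])).
  - by rewrite !subword_count_cat1 !subword_count_nseq1 !letter_neq !mul1n.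
  - by rewrite !subword_count_cat1 !subword_count_nseq1 !letter_neq !addn0.
  (* The goal counts [c b] but [h_bc] counts [b c]; [subword_count_pair] converts, and [h_d] times
     the common number of letters [c] balances the products. *)
  - have := subword_count_pair U cb; have := subword_count_pair U' cb.
    have /= := congr1 (muln^~ (sc u [:: c] + sc v [:: c])) h_d.
    rewrite !subword_count_cat2 !subword_count_cat1 !subword_count_nseq2 //.
    rewrite !subword_count_nseq1 !letter_neq !mul1n !mul0n !addn0 h_c -h_c !mulnDr !mulnDl.
    by clear -h_bc; lia.
  have h_d' : sc t [:: b] + d = sc t' [:: b] + d' by clear -h_d h_b; lia.
  have [||||||t1 [Vt1 V't1]] := @MSE_binary_prefix _ b a V V' d' d ba.
  - rewrite all_cat binaryC [all _ t]binaryC t_ab andbT.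
    by case/andP: (binary_nseq a b (sc v [:: a])).
  - rewrite all_cat binaryC [all _ t']binaryC t'_ab andbT.
    by case/andP: (binary_nseq a b (sc v' [:: a])).
  - by rewrite orbC.
  - by rewrite !subword_count_cat1 !subword_count_nseq1 !letter_neq !mul1n.
  - by rewrite !subword_count_cat1 !subword_count_nseq1 !letter_neq.
  - have := subword_count_pair V ba; have := subword_count_pair V' ba.
    have /= := congr1 (muln^~ (sc v [:: a] + sc t [:: a])) h_d'.
    rewrite !subword_count_cat2 !subword_count_cat1 !subword_count_nseq2 //.
    rewrite !subword_count_nseq1 !letter_neq !mul1n !mul0n !add0n h_a -h_a !mulnDr !mulnDl.
    by clear -h_ab; lia.
  have wUV : MSE w (U ++ V).
    rewrite def_w /U /V -catA; apply: MSE_cat; first exact: MSE_refl.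
    by rewrite catA; apply: MSE_cat; [apply: MSE_binary_sorted|apply: MSE_refl].
  have wUV' : MSE w' (U' ++ V').
    rewrite def_w' /U' /V' -catA; apply: MSE_cat; first exact: MSE_refl.
    rewrite catA; apply: MSE_cat; last exact: MSE_refl.
    by apply: MSE_binary_sorted; rewrite ?h_ac.
  apply: (MSE_trans wUV); apply: (MSE_trans (MSE_cat Uu1 Vt1)).
  apply: MSE_sym; apply: (MSE_trans wUV'); apply: (MSE_trans (MSE_cat U'u1 V't1)).
  (* Both words have become [u1], then [d + d'] letters [b], then [t1]. *)
  rewrite -!catA !(catA (nseq _ _)) -!nseqD addnC; exact: MSE_refl.
have eq_t : sc t [:: b] = sc t' [:: b].
  by move/eqP: h_acb; rewrite h_ac eqn_pmul2l // => /eqP.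
have eq_u : sc u [:: b] = sc u' [:: b] by clear -h_b eq_t; lia.
rewrite -eq_t in h_ab; rewrite -eq_u in h_bc.
(* A surplus of [c] in [u] over [u'], or of [a] in [t] over [t'], is matched by an equal deficit in
   [v] against [v']. *)
have [d [d' [dd' h_d]]] := shift_amounts (sc u [:: c]) (sc u' [:: c]).
have [e [e' [ee' h_e]]] := shift_amounts (sc t [:: a]) (sc t' [:: a]).
have h_d' : sc v [:: c] + d = sc v' [:: c] + d' by clear -h_d h_c; lia.
have h_e' : sc v [:: a] + e = sc v' [:: a] + e' by clear -h_e h_a; lia.
have [|||||u1 [uu1 u'u1]] := @MSE_binary_suffix _ b c u u' d d' bc _ _ dd' => //.
  have /= := congr1 (muln (sc u [:: b])) h_d'.
  by rewrite !mulnDr; clear -h_bc; lia.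
have [|||||t1 [tt1 t't1]] := @MSE_binary_prefix _ a b t t' e e' ab _ _ ee' => //.
  have /= := congr1 (muln^~ (sc t [:: b])) h_e'.
  by rewrite !mulnDl ![sc t [:: b] * _]mulnC; clear -h_ab; lia.
(* Letters [c] in front and letters [a] behind create no new [a c], so the two enlarged middle words
   agree in all three binary counts. *)
have middle : MSE (nseq d c ++ v ++ nseq e a) (nseq d' c ++ v' ++ nseq e' a).
  have nc n : binary a c (nseq n c) by case/andP: (binary_nseq a c n).
  have na n : binary a c (nseq n a) by case/andP: (binary_nseq a c n).
  apply: (MSE_binary ac).
  - by rewrite !all_cat nc v_ac na.
  - by rewrite !all_cat nc v'_ac na.
  - by rewrite !subword_count_cat1 !subword_count_nseq1 !letter_neq !mul1n.
  - rewrite !subword_count_cat1 !subword_count_nseq1 !letter_neq !mul1n !addn0.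
    by rewrite ![_ + sc _ _]addnC.
  - rewrite !subword_count_cat2 !subword_count_cat1 !subword_count_nseq2 //.
    by rewrite !subword_count_nseq1 !letter_neq !muln0 !addn0 h_ac.
rewrite def_w def_w'.
apply: (MSE_trans (MSE_cat uu1 (MSE_cat (MSE_refl v) tt1))).
apply: MSE_sym.
apply: (MSE_trans (MSE_cat u'u1 (MSE_cat (MSE_refl v') t't1))).
have := MSE_ctx u1 t1 (MSE_sym middle); rewrite -!catA; exact.
Qed.
End Converse.
End Ternary.

(** * From Parikh matrices to subword counts, and the theorem *)

Lemma strongly_M_subword_count (Sigma : finType) (w w' G : seq Sigma) i j :
  strongly_M_equiv w w' -> ordered_alphabet G -> i + j <= size G ->
  subword_count w (take j (drop i G)) = subword_count w' (take j (drop i G)).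
Proof.
move=> ww' G_ord ij; have [uG _] := G_ord.
have lt_i : i < (size G).+1 by rewrite ltnS (leq_trans (leq_addr j i)).
(* The factor of [G] with length [j] at position [i] belongs to row [i], column [i + j]. *)
have /= := congr1 (fun A : 'M_((size G).+1) =>
  A (Ordinal lt_i) (@Ordinal (size G).+1 (i + j) ij)) (ww' G G_ord).
by rewrite !parikh_mx_entry //= leq_addr addKn.
Qed.

Lemma MSE_strongly_M (Sigma : finType) (w w' : seq Sigma) :
  MSE_equiv w w' -> strongly_M_equiv w w'.
Proof.
move=> ww' G [uG _]; apply/matrixP => i j; rewrite !parikh_mx_entry //.
by case: ifP => // _; apply: MSE_subword_count ww'; rewrite take_uniq ?drop_uniq.
Qed.

Theorem theorem4p2 (Sigma : finType) (a b c : Sigma)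
    (h_distinct : uniq [:: a; b; c])
    (h_Sigma : [set: Sigma] = [set a; b; c])
    (w w' : seq Sigma)
    (h_eq : subword_count w [:: a; b; c] = subword_count w' [:: a; b; c])
    (h_le : subword_count w' [:: a; b; c] <= 1) :
  strongly_M_equiv w w' <-> MSE_equiv w w'.
Proof.
split; last exact: MSE_strongly_M.
move=> ww'; have abc t : t \in [:: a; b; c].
  by have := in_setT t; rewrite h_Sigma !inE orbA.
have [ab bc ac] : [/\ a != b, b != c & a != c].
  by move: h_distinct; rewrite /= !inE negb_or andbT => /andP[/andP[]].
(* Two orders provide all counts: a < b < c gives those of single letters, [a b] and [b c], while a
   < c < b gives those of [a c] and [a c b]. *)
have ord_abc : ordered_alphabet [:: a; b; c] by split=> // t; rewrite abc.
have ord_acb : ordered_alphabet [:: a; c; b].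
  split=> [|t]; last by have := abc t; rewrite !inE [(t == c) || _]orbC => ->.
  by rewrite /= !inE negb_or ab ac eq_sym bc.
have e_abc i j := @strongly_M_subword_count _ _ _ _ i j ww' ord_abc.
have e_acb i j := @strongly_M_subword_count _ _ _ _ i j ww' ord_acb.
have e_a := e_abc 0 1 isT; have e_b := e_abc 1 1 isT; have e_c := e_abc 2 1 isT.
have e_ab := e_abc 0 2 isT; have e_bc := e_abc 1 2 isT.
have e_ac := e_acb 0 2 isT; have e_full := e_acb 0 3 isT.
have [w'_eq0|w'_gt0] := posnP (subword_count w' [:: a; b; c]).
  by apply: (@MSE_abc_avoiding _ a b c); rewrite ?h_eq.
by apply: (@MSE_abc_once _ a b c); rewrite ?h_eq //; apply/eqP; rewrite eqn_leq h_le.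
Qed.
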